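(* Every persuasive privacy guarantee satisfies the receiver post-processing property. That is, for every $(\mathcal{S},\mathcal{Q}_x,\kappa,\delta)$, if a mechanism $M$ from $\mathsf{X}$ to $(\mathsf{T}_1,\mathcal{T}_1)$ is $(\mathcal{S},\mathcal{Q}_x,\kappa,\delta)$-PP, then $M\otimes K$ is $(\mathcal{S},\mathcal{Q}_x,\kappa,\delta)$-PP for every Markov kernel $K$ from $(\mathsf{T}_1,\mathcal{T}_1)$ to a measurable space $(\mathsf{T}_2,\mathcal{T}_2)$, i.e. every post-processing kernel $K$ independent of the data $x$.
   Context: $(\mathsf{X},\mathcal{X})$ is a measurable space of datasets and $\mathcal{P}$ a family of probability distributions on it. A mechanism is a Markov kernel $M$ from $\mathsf{X}$ to a measurable space; $\mathbb{P}_x$ denotes probability when the output $T\sim M(x,\cdot)$. For a kernel $K$ independent of the data, $(M\otimes K)(x,\mathrm{d}(t_1,t_2))=M(x,\mathrm{d}t_1)K(t_1,\mathrm{d}t_2)$ (both outputs are released). Posterior: for a prior $Q\in\mathcal{P}$, $Q_T=Q(\cdot\mid M,T)$ is the regular conditional distribution (Bayes posterior) of the data given the observed output $T$, when data $X\sim Q$ and $T\mid X\sim M(X,\cdot)$. Spaces are assumed regular enough that these exist and are almost surely unique. For a two-stage mechanism $M\otimes K$, the version of the posterior after observing $(T_1,T_2)$ is the one obtained by sequential Bayesian updating: first update $Q$ to $Q_{T_1}$ using $T_1$ and $M$, then update $Q_{T_1}$ using $T_2$ and the kernel $x\mapsto K(T_1,\cdot)$. Scores: a scoring rule $S$ maps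 $(Q,x)\in\mathcal{P}\times\mathsf{X}$ to $\mathbb{R}\cup\{\pm\infty\}$; it is proper if $\mathbb{E}_{X\sim Q}[S(Q,X)]\le\mathbb{E}_{X\sim Q}[S(P,X)]$ for all $P,Q\in\mathcal{P}$. $\mathcal{S}$ is a non-empty set of proper scoring rules. Persuasive privacy: for each $x\in\mathsf{X}$ let $\mathcal{Q}_x\subset\mathcal{P}$ be a class of priors, and let $\kappa,\delta\ge0$. $M$ is $(\mathcal{S},\mathcal{Q}_x,\kappa,\delta)$-PP if $$\inf_{S\in\mathcal{S}}\inf_{x\in\mathsf{X}}\inf_{Q\in\mathcal{Q}_x}\mathbb{P}_x\left[\Delta_S(Q,T,x)\le\kappa\right]\ge1-\delta,\qquad \Delta_S(Q,T,x)=S(Q,x)-S(Q_T,x),$$ where a difference of equal infinities is $0$. A persuasive privacy guarantee is a choice of $(\mathcal{S},\mathcal{Q}_x,\kappa,\delta)$. *)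

(* Defs.v *)
From HB Require Import structures.
From mathcomp Require Import all_boot all_order all_algebra.
From mathcomp Require Import mathcomp_extra boolp classical_sets functions.
From mathcomp Require Import reals ereal topology normedtype sequences measure.
From mathcomp Require Import measurable_realfun numfun lebesgue_measure.
From mathcomp Require Import lebesgue_integral kernel.

Set Implicit Arguments.
Unset Strict Implicit.
Unset Printing Implicit Defensive.

Import Order.TTheory GRing.Theory Num.Theory.

Local Open Scope classical_set_scope.
Local Open Scope ring_scope.
Local Open Scope ereal_scope.

(* [release_both M K] is M (x) K: the underlying set function is the library's
   [kproduct_snd M K], i.e. A |-> \int M(x, dt1) \int K(t1, dt2) 1_A(t1, t2). *)
Section release_both.
Context d0 d1 d2 (X : measurableType d0) (T1 : measurableType d1)
  (T2 : measurableType d2) (R : realType).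
Variables (M : R.-pker X ~> T1) (K : R.-pker T1 ~> T2).

Definition release_both : X -> {measure set (T1 * T2) -> \bar R} :=
  mkproduct M (kernel.kernel_snd K).

Lemma release_bothE x A : release_both x A = kproduct_snd M K x A.
Proof. by []. Qed.

HB.instance Definition _ := Kernel.on release_both.

Let release_both_prob x : release_both x setT = 1.
Proof.
rewrite release_bothE /kproduct_snd /kproduct.
rewrite (eq_integral (cst 1)); last first.
  move=> t _; rewrite /kernel.intker_indic /=.
  rewrite (eq_integral (cst 1)); last by move=> u _; rewrite indicT.
  by rewrite integral_cst//= mul1e prob_kernel.
by rewrite integral_cst//= mul1e prob_kernel.
Qed.

HB.instance Definition _ :=
  Kernel_isProbability.Build _ _ _ _ _ release_both release_both_prob.
End release_both.

(* The mechanism x |-> K(t1, .), which ignores the data. *)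
Section fixed_output.
Context d0 d1 d2 (X : measurableType d0) (T1 : measurableType d1)
  (T2 : measurableType d2) (R : realType).
Variables (K : R.-pker T1 ~> T2) (t1 : T1).

Definition fixed_output (_ : X) : {measure set T2 -> \bar R} := K t1.

Let measurable_fixed_output U : measurable U ->
  measurable_fun [set: X] (fixed_output ^~ U).
Proof. by move=> _; exact: measurable_cst. Qed.

HB.instance Definition _ :=
  isKernel.Build _ _ _ _ _ fixed_output measurable_fixed_output.

Let fixed_output_prob x : fixed_output x setT = 1.
Proof. exact: prob_kernel. Qed.

HB.instance Definition _ :=
  Kernel_isProbability.Build _ _ _ _ _ fixed_output fixed_output_prob.
End fixed_output.

(* Law of the output T when X ~ Q and T | X ~ N(X, .). *)
Section output_law.
Context d d' (X : measurableType d) (T : measurableType d') (R : realType).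
Variables (Q : probability X R) (N : R.-pker X ~> T).

Definition output_law (B : set T) : \bar R := \int[Q]_x N x B.

Let output_law0 : output_law set0 = 0.
Proof. by apply: integral0_eq => x _; rewrite measure0. Qed.

Let output_law_ge0 B : 0 <= output_law B.
Proof. exact: integral_ge0. Qed.

Let output_law_sigma_additive : semi_sigma_additive output_law.
Proof.
move=> F mF tF mUF; rewrite [X in _ --> X](_ : _ =
  \int[Q]_x (\sum_(n <oo) N x (F n))); last first.
  apply: eq_integral => V _.
  by apply/esym/cvg_lim => //; exact/measure_semi_sigma_additive.
rewrite integral_nneseries//; last by move=> n; exact: measurable_kernel.
by apply: is_cvg_ereal_nneg_natsum => n _; exact: integral_ge0.
Qed.

HB.instance Definition _ := isMeasure.Build _ _ _ output_law
  output_law0 output_law_ge0 output_law_sigma_additive.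
End output_law.

Section posterior.
Context d (X : measurableType d) (R : realType).

(* [post] is a version of the regular conditional distribution of X given T,
   when X ~ Q and T | X ~ N(X, .). *)
Definition is_posterior d' (T : measurableType d') (Q : probability X R)
    (N : R.-pker X ~> T) (post : T -> probability X R) : Prop :=
  measurable_fun [set: T] (post : T -> pprobability X R) /\
  forall (A : set X) (B : set T), measurable A -> measurable B ->
    \int[output_law Q N]_(t in B) post t A = \int[Q]_(x in A) N x B.

(* Distributions are compared on measurable sets only: the values of a
   [probability X R] on other sets carry no information. *)
Definition same_law (P Q : probability X R) : Prop :=
  forall A : set X, measurable A -> P A = Q A.

(* Posteriors on X exist and are almost surely unique (this holds, e.g., for
   every standard Borel space X). *)
Definition posterior_regular : Prop :=
  forall (d' : measure_display) (T : measurableType d') (Q : probability X R)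
         (N : R.-pker X ~> T),
    exists2 post : T -> probability X R, is_posterior Q N post &
      forall post' : T -> probability X R, is_posterior Q N post' ->
        {ae output_law Q N, forall t, same_law (post t) (post' t)}.

End posterior.
Arguments posterior_regular {d} X R.

Section persuasive_privacy.
Context d (X : measurableType d) (R : realType) (P : set (probability X R)).

(* The elements of the family P, as a type, and their underlying measures. *)
Definition law (Q : P) : probability X R := \val Q.

(* A score is a function on P * X, so that S(Q_T, x) requires Q_T to be in P:
   the posterior versions used below are P-valued. *)
Definition score : Type := P -> X -> \bar R.

Definition is_scoring_rule (S : score) : Prop :=
  forall (Q Q' : P) (x : X), same_law (law Q) (law Q') -> S Q x = S Q' x.

Definition expectation_exists (Q : probability X R) (f : X -> \bar R) : Prop :=
  measurable_fun [set: X] f /\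
  (\int[Q]_x f^\+ x < +oo \/ \int[Q]_x f^\- x < +oo).

(* The first conjunct, taken over all pairs, says that both expectations of the
   second one are well-defined elements of [-oo, +oo]. *)
Definition proper_score (S : score) : Prop :=
  forall Q Q' : P,
    expectation_exists (law Q) (S Q') /\
    \int[law Q]_x S Q x <= \int[law Q]_x S Q' x.

(* [Delta S Q Q' x] is S(Q, x) - S(Q', x), a difference of equal infinities
   being 0. (In the library, +oo - +oo and -oo - -oo are -oo.) *)
Definition Delta (S : score) (Q Q' : P) (x : X) : \bar R :=
  if S Q x == S Q' x then 0 else S Q x - S Q' x.

Section mechanism.
Context d' (T : measurableType d').
Variables (SS : set score) (Qx : X -> set P) (kappa delta : R).

(* The event whose probability is bounded, for a version [post] of the
   posteriors: [post Q t] is Q_t. *)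
Definition low_gain (post : P -> T -> P) (S : score) (Q : P) (x : X) : set T :=
  [set t | Delta S Q (post Q t) x <= kappa%:E].

(* The probabilities occurring in the definition of persuasive privacy are
   those of measurable events. *)
Definition low_gain_measurable (post : P -> T -> P) : Prop :=
  forall (S : score) (x : X) (Q : P),
    SS S -> Qx x Q -> measurable (low_gain post S Q x).

Definition persuasively_private (N : R.-pker X ~> T) (post : P -> T -> P) :
    Prop :=
  (1 - delta)%:E <=
  ereal_inf [set
    ereal_inf [set
      ereal_inf [set N x (low_gain post S Q x) | Q in Qx x]
    | x in [set: X]]
  | S in SS].

End mechanism.

(* Posterior versions of M, for all priors in P. *)
Definition posterior_version d' (T : measurableType d') (N : R.-pker X ~> T)
    (post : P -> T -> P) : Prop :=
  forall Q : P, is_posterior (law Q) N (law \o post Q).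

(* Sequential Bayesian updating: the posterior [post1 Q t1] obtained from the
   first output is the prior of an update by t2 for the mechanism
   x |-> K(t1, .). *)
Definition sequential_version d1 d2 (T1 : measurableType d1)
    (T2 : measurableType d2) (K : R.-pker T1 ~> T2) (post1 : P -> T1 -> P)
    (post12 : P -> T1 * T2 -> P) : Prop :=
  forall Q : P,
    measurable_fun [set: T1 * T2]
      (law \o post12 Q : T1 * T2 -> pprobability X R) /\
    forall t1 : T1, is_posterior (law (post1 Q t1)) (fixed_output K t1)
                      (fun t2 => law (post12 Q (t1, t2))).

End persuasive_privacy.

Arguments law {d X R P}.
Arguments is_scoring_rule {d X R P}.
Arguments proper_score {d X R P}.
Arguments Delta {d X R P}.
Arguments low_gain {d X R P d' T}.
Arguments low_gain_measurable {d X R P d' T}.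
Arguments persuasively_private {d X R P d' T}.
Arguments posterior_version {d X R P d' T}.
Arguments sequential_version {d X R P d1 d2 T1 T2}.

(* Main.v *)
Require Import Defs.
From HB Require Import structures.
From mathcomp Require Import all_boot all_order all_algebra.
From mathcomp Require Import mathcomp_extra boolp classical_sets functions.
From mathcomp Require Import reals ereal topology normedtype sequences measure.
From mathcomp Require Import measurable_realfun numfun lebesgue_measure.
From mathcomp Require Import lebesgue_integral kernel.

Set Implicit Arguments.
Unset Strict Implicit.
Unset Printing Implicit Defensive.

Import Order.TTheory GRing.Theory Num.Theory.

Local Open Scope classical_set_scope.
Local Open Scope ring_scope.

(** Receiver post-processing costs nothing, because an observer who has already
seen [t1] learns nothing from [t2 ~ K(t1, .)]: its law does not depend on the
data.  In terms of Bayes updates, the constant map equal to the prior is a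
posterior for any data-independent mechanism
([constant_posterior_fixed_output]), so by almost sure uniqueness the second
update returns its prior for [K(t1, .)]-almost every [t2]
([sequential_update_trivial]).  Scores only depend on the law of the reported
distribution, so the gain after [(t1, t2)] equals, almost surely, the gain
after [t1].

The event that the gain after both outputs is at most [kappa] therefore has
full [K(t1, .)]-measure above each [t1] at which the gain after the first output
is at most [kappa].  Integrating over [t1 ~ M(x, .)]
([release_both_ge]), its probability under [M (x) K] is at least the
probability of the one-stage event under [M], pointwise in the score, the data
set and the prior, and hence after taking infima. *)

Local Open Scope ereal_scope.

Section receiver_post_processing.
Context (R : realType) (d d1 d2 : measure_display) (X : measurableType d)
  (T1 : measurableType d1) (T2 : measurableType d2).

Lemma output_law_fixed_output (K : R.-pker T1 ~> T2) (t1 : T1)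
    (Q : probability X R) (B : set T2) :
  output_law Q (fixed_output K t1) B = K t1 B.
Proof.
rewrite /output_law (eq_integral (cst (K t1 B))) => [|x _ //].
by rewrite integral_cst// -[RHS]mule1 [X in _ * X]probability_setT.
Qed.

(** Both sides of the defining identity equal [Q A * K t1 B]: under a
data-independent mechanism the data and the output are independent. *)
Lemma constant_posterior_fixed_output (K : R.-pker T1 ~> T2) (t1 : T1)
    (Q : probability X R) :
  is_posterior Q (fixed_output K t1) (cst Q).
Proof.
split=> [|A B mA mB]; first exact: measurable_cst.
rewrite (eq_integral (cst (Q A))) => [|t _ //].
rewrite [RHS](eq_integral (cst (K t1 B))) => [|x _ //].
by rewrite !integral_cst// [X in _ * X = _]output_law_fixed_output muleC.
Qed.

Lemma ae_fixed_output (K : R.-pker T1 ~> T2) (t1 : T1) (Q : probability X R)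
    (p : T2 -> Prop) :
  {ae output_law Q (fixed_output K t1), forall t, p t} ->
  {ae K t1, forall t, p t}.
Proof.
by move=> [N [mN N0 pN]]; exists N; split; rewrite // -N0 output_law_fixed_output.
Qed.

Lemma sequential_update_trivial (hX : posterior_regular X R)
    (K : R.-pker T1 ~> T2) (t1 : T1) (Q : probability X R)
    (post : T2 -> probability X R) :
  is_posterior Q (fixed_output K t1) post ->
  {ae K t1, forall t2, same_law Q (post t2)}.
Proof.
move=> hpost; apply: (@ae_fixed_output _ _ Q).
(* Uniqueness compares any version with one reference version, so the constant
   version and [post] agree by going through it. *)
have [ref _ uniq] := hX _ _ Q (fixed_output K t1).
apply: filterS2 (uniq _ (constant_posterior_fixed_output K t1 Q))
  (uniq _ hpost) => t2 refQ refpost A mA.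
by rewrite -refpost// refQ.
Qed.

Lemma probability_ae_eq1 (K : R.-pker T1 ~> T2) (t1 : T1) (A : set T2) :
  measurable A -> {ae K t1, forall t, A t} -> K t1 A = 1.
Proof.
move=> mA /(negligibleP _ (measurableC mA)) A0.
rewrite -(@prob_kernel _ _ _ _ _ K t1) -(setvU A) measureU ?setICl//.
  by rewrite A0 add0e.
exact: measurableC.
Qed.

(** The mass of [A] under [M (x) K] is the [M x]-integral of the
[K t1]-mass of the section of [A] above [t1], which dominates the indicator of
[B] as soon as the sections above [B] have full mass. *)
Lemma release_both_ge (M : R.-pker X ~> T1) (K : R.-pker T1 ~> T2) (x : X)
    (B : set T1) (A : set (T1 * T2)) :
  measurable B -> measurable A ->
  (forall t1, B t1 -> {ae K t1, forall t2, A (t1, t2)}) ->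
  M x B <= release_both M K x A.
Proof.
move=> mB mA AB; rewrite release_bothE /kproduct_snd /kproduct.
pose kX : R.-ftker X * T1 ~> T2 := kernel.kernel_snd K.
rewrite -[B in leLHS]setIT -integral_indic//.
apply: ge0_le_integral => //.
- by apply/measurable_EFinP; exact: measurable_indic.
- exact: measurable_fun_pair2 (kernel.measurable_intker_indic kX mA).
move=> t1 _; rewrite (kernel.intker_indicE kX)//.
rewrite indicE; have [/set_mem Bt1|_] := boolP (t1 \in B); last exact: measure_ge0.
rewrite /kX/= (_ : kernel.kernel_snd K (x, t1) _ = 1)//.
apply: probability_ae_eq1; first exact: measurable_xsection.
by apply: filterS (AB _ Bt1) => t2; rewrite /xsection/= inE.
Qed.

End receiver_post_processing.

Lemma Delta_same_law (R : realType) (d : measure_display)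
    (X : measurableType d) (P : set (probability X R)) (S : score P)
    (Q Q1 Q2 : P) (x : X) :
  is_scoring_rule S -> same_law (law Q1) (law Q2) ->
  Delta S Q Q1 x = Delta S Q Q2 x.
Proof. by move=> ruleS Q12; rewrite /Delta (ruleS _ _ x Q12). Qed.

Local Close Scope ereal_scope.

Theorem proposition4 (R : realType) (d d1 d2 : measure_display)
    (X : measurableType d) (T1 : measurableType d1) (T2 : measurableType d2)
    (P : set (probability X R)) (SS : set (score P)) (Qx : X -> set P)
    (kappa delta : R) (M : R.-pker X ~> T1) (K : R.-pker T1 ~> T2)
    (post1 : P -> T1 -> P) (post12 : P -> T1 * T2 -> P)
    (hX : posterior_regular X R)
    (hSS0 : SS !=set0)
    (hSS : forall S, SS S -> is_scoring_rule S /\ proper_score S)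
    (hkappa : 0 <= kappa) (hdelta : 0 <= delta)
    (hpost1 : posterior_version M post1)
    (hpost12 : sequential_version K post1 post12)
    (hmeas1 : low_gain_measurable SS Qx kappa post1)
    (hmeas12 : low_gain_measurable SS Qx kappa post12) :
  persuasively_private SS Qx kappa delta M post1 ->
  persuasively_private SS Qx kappa delta (release_both M K) post12.
Proof.
move=> private1; apply: le_ereal_inf_tmp => _ [S SS_S <-].
apply: le_ereal_inf_tmp => _ [x _ <-].
apply: le_ereal_inf_tmp => _ [Q QxQ <-].
apply: (@le_trans _ _ (M x (low_gain kappa post1 S Q x))).
  apply: (le_trans private1); apply: ge_ereal_inf; eexists; [by exists S|].
  apply: ge_ereal_inf; eexists; [by exists x|].
  by apply: ereal_inf_lbound; exists Q.
apply: release_both_ge; [exact: hmeas1|exact: hmeas12|move=> t1 gain1].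
have [_ /(_ t1)/(sequential_update_trivial hX)] := hpost12 Q.
apply: filterS => t2 post12E.
by rewrite /low_gain/= -(Delta_same_law Q x (hSS _ SS_S).1 post12E).
Qed.
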